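(* Suppose the stochastic basis $\psi_1,\dots,\psi_K$ satisfies property (P1): there is an orthogonal matrix $V\in\mathbb{R}^{K\times K}$, independent of $\hat v$, such that for every $\hat v\in\mathbb{R}^K$, $\mathcal{P}(\hat v)=V\Lambda_{\hat v}V^T$ with $\Lambda_{\hat v}$ diagonal. Then the two stochastic Galerkin shallow water systems for $(\hat h,\hat q)\in\mathbb{R}^K\times\mathbb{R}^K$, $$\frac{\partial}{\partial t}\begin{pmatrix}\hat h\\ \hat q\end{pmatrix}+\frac{\partial}{\partial x}\begin{pmatrix}\hat q\\ \mathcal{P}(\hat q)\mathcal{P}^{-1}(\hat h)\hat q+\tfrac12 g\,\mathcal{P}(\hat h)\hat h\end{pmatrix}=\begin{pmatrix}0\\ -g\,\mathcal{P}(\hat h)\frac{\partial}{\partial x}\hat b\end{pmatrix}$$ and $$\frac{\partial}{\partial t}\begin{pmatrix}\hat h\\ \hat q\end{pmatrix}+\frac{\partial}{\partial x}\begin{pmatrix}\hat q\\ \mathcal{P}\big(\mathcal{P}^{-1}(\hat h^{1/2})\hat q\big)\mathcal{P}^{-1}(\hat h^{1/2})\hat q+\tfrac12 g\,\mathcal{P}\big(\mathcal{P}(\hat h^{1/2})\hat h^{1/2}\big)\mathcal{P}(\hat h^{1/2})\hat h^{1/2}\end{pmatrix}=\begin{pmatrix}0\\ -g\,\mathcal{P}(\hat h)\frac{\partial}{\partial x}\hat b\end{pmatrix}$$ are identical; that is, their flux functions coincide as functions of $(\hat h,\hat q)$ for every $\hat q\in\mathbb{R}^K$ and every $\hat h\in\mathbb{R}^K$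 with $\mathcal{P}(\hat h)$ positive definite, where $\hat h^{1/2}$ is a solution of $\mathcal{P}(\hat h^{1/2})\hat h^{1/2}=\hat h$.
   Context: Let $\rho$ be a probability density on $\mathbb{R}^n$, $\langle y,z\rangle=\int_{\mathbb{R}^n}y(s)z(s)\rho(s)\,ds$, and let $\psi_1,\dots,\psi_K$ be real functions, orthonormal with respect to $\langle\cdot,\cdot\rangle$, with finite triple products. The stochastic Galerkin matrix of $\hat v\in\mathbb{R}^K$ is the symmetric $K\times K$ matrix with entries $[\mathcal{P}(\hat v)]_{ij}=\sum_{k=1}^K\hat v_k\langle\psi_i\psi_j,\psi_k\rangle$. It satisfies $\mathcal{P}(\hat v)\hat w=\mathcal{P}(\hat w)\hat v$. $\mathcal{P}^{-1}(\hat v)$ denotes the inverse matrix $(\mathcal{P}(\hat v))^{-1}$. The vectors $\hat h,\hat q,\hat b\in\mathbb{R}^K$ contain the spectral coefficients of water height, discharge and bottom topography, and $g>0$ is the gravitational constant. The vector $\hat h^{1/2}$ is defined as the solution of $\mathcal{P}(\hat h^{1/2})\hat h^{1/2}=\hat h$; it is assumed throughout that such a solution exists and that the inverses appearing in the equations exist. *)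

(* Defs.v *)
From HB Require Import structures.
From mathcomp Require Import all_boot all_order all_algebra.
From mathcomp Require Import all_classical all_reals all_analysis.
Import Order.TTheory GRing.Theory Num.Theory.
Import numFieldNormedType.Exports.

Set Implicit Arguments.
Unset Strict Implicit.
Unset Printing Implicit Defensive.

Local Open Scope classical_set_scope.
Local Open Scope ring_scope.

Section TupleMeasureStep.
Context d (T : measurableType d) (R : realType) (n : nat).
Variable m : {sigma_finite_measure set T -> \bar R}.
Variable mu : {sigma_finite_measure set (n.-tuple T) -> \bar R}.

Definition tcons (p : T * n.-tuple T) : n.+1.-tuple T := [tuple of p.1 :: p.2].

Lemma measurable_tcons : measurable_fun setT tcons.
Proof. exact: measurable_cons. Qed.

Definition tuple_measure_step : set (n.+1.-tuple T) -> \bar R :=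
  pushforward (m \x mu)%E tcons.

Let step0 : tuple_measure_step set0 = 0%E.
Proof. by rewrite /tuple_measure_step /pushforward preimage_set0 measure0. Qed.

Let step_ge0 A : (0 <= tuple_measure_step A)%E.
Proof. by rewrite /tuple_measure_step /pushforward measure_ge0. Qed.

Let step_sigma_additive : semi_sigma_additive tuple_measure_step.
Proof.
move=> F mF tF mUF; rewrite /tuple_measure_step /pushforward preimage_bigcup.
apply: measure_semi_sigma_additive.
- by move=> k; rewrite -[X in measurable X]setTI; exact: measurable_tcons.
- apply/trivIsetP => /= i j _ _ ij; rewrite -preimage_setI.
  by move/trivIsetP : tF => /(_ _ _ _ _ ij) ->//; rewrite preimage_set0.
- by rewrite -preimage_bigcup -[X in measurable X]setTI;
    exact: measurable_tcons.
Qed.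

HB.instance Definition _ := isMeasure.Build _ _ _ tuple_measure_step
  step0 step_ge0 step_sigma_additive.

Let step_sigma_finite : sigma_finite setT tuple_measure_step.
Proof.
have /sigma_finiteP[F [TF ndF Foo]] := sigma_finiteT m.
have /sigma_finiteP[G [TG ndG Goo]] := sigma_finiteT mu.
pose hd (s : n.+1.-tuple T) := thead s.
pose tl (s : n.+1.-tuple T) : n.-tuple T := [tuple of behead s].
have mhd : measurable_fun setT hd by exact: measurable_tnth.
have mtl : measurable_fun setT tl by exact: measurable_behead.
exists (fun k => hd @^-1` F k `&` tl @^-1` G k).
  apply/esym; rewrite -subTset => s _.
  have : [set: T] (hd s) by [].
  have : [set: n.-tuple T] (tl s) by [].
  rewrite TF TG => -[j _ Gj] [k _ Fk]; exists (maxn k j) => //; split.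
  - by rewrite /preimage /=; move: (hd s) Fk; exact/subsetPset/ndF/leq_maxl.
  - by rewrite /preimage /=; move: (tl s) Gj; exact/subsetPset/ndG/leq_maxr.
move=> k; have [mF Fk] := Foo k; have [mG Gk] := Goo k; split.
  apply: measurableI; rewrite -[X in measurable X]setTI; first exact: mhd.
  exact: mtl.
rewrite /tuple_measure_step /pushforward.
have -> : tcons @^-1` (hd @^-1` F k `&` tl @^-1` G k) = F k `*` G k.
  apply/seteqP; split=> -[x s] /=; rewrite /hd /tl /tcons theadE /=;
  by rewrite (_ : [tuple of _] = s) //; exact/val_inj.
by rewrite product_measure1E // lte_mul_pinfty // ge0_fin_numE.
Qed.

HB.instance Definition _ := Measure_isSigmaFinite.Build _ _ _
  tuple_measure_step step_sigma_finite.

End TupleMeasureStep.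

(* n-fold product of m; on the one-point space of 0-tuples it is the unit
   mass. *)
Fixpoint tuple_measure d (T : measurableType d) (R : realType)
    (m : {sigma_finite_measure set T -> \bar R}) (n : nat) :
    {sigma_finite_measure set (n.-tuple T) -> \bar R} :=
  match n with
  | 0 => \d_([tuple] : 0.-tuple T)
  | k.+1 => tuple_measure_step m (tuple_measure m k)
  end.

(* R^n with the product of the Borel sigma-algebras. *)
Notation euclid R n := (n.-tuple (measurableTypeR R)).

Definition lebesgue_tuple (R : realType) (n : nat) :
    {sigma_finite_measure set (euclid R n) -> \bar R} :=
  tuple_measure (@lebesgue_measure R) n.

Section StochasticBasis.
Context (R : realType) (n K : nat).
Implicit Types (rho y z : euclid R n -> R) (psi : 'I_K -> euclid R n -> R).

Definition probability_density rho : Prop :=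
  [/\ measurable_fun setT rho, (forall s, 0 <= rho s) &
      (\int[lebesgue_tuple R n]_s (rho s)%:E = 1)%E].

Definition inner rho y z : R :=
  \int[lebesgue_tuple R n]_s (y s * z s * rho s).

(* [Rintegral] is total; this says that <y, z> is a convergent integral. *)
Definition inner_finite rho y z : Prop :=
  (lebesgue_tuple R n).-integrable setT (fun s => (y s * z s * rho s)%:E).

Definition orthonormal_family rho psi : Prop :=
  forall i j, inner_finite rho (psi i) (psi j) /\
              inner rho (psi i) (psi j) = (i == j)%:R.

Definition finite_triple_products rho psi : Prop :=
  forall i j k, inner_finite rho (psi i \* psi j) (psi k).

Definition galerkin_mx rho psi (v : 'cV[R]_K) : 'M[R]_K :=
  \matrix_(i, j) \sum_(k < K) v k 0 * inner rho (psi i \* psi j) (psi k).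

Definition property_P1 rho psi : Prop :=
  exists V : 'M[R]_K, V^T *m V = 1%:M /\
    forall v : 'cV[R]_K, exists L : 'M[R]_K,
      is_diag_mx L /\ galerkin_mx rho psi v = V *m L *m V^T.

End StochasticBasis.

Definition posdefmx (R : realType) (K : nat) (A : 'M[R]_K) : Prop :=
  A^T = A /\ forall x : 'cV[R]_K, x != 0 -> 0 < (x^T *m A *m x) 0 0.

Section ShallowWater.
Context (R : realType) (K : nat).
Variables (g : R) (P : 'cV[R]_K -> 'M[R]_K).
Implicit Types h q r : 'cV[R]_K.

Definition flux h q : 'cV[R]_(K + K) :=
  col_mx q (P q *m invmx (P h) *m q + (g / 2) *: (P h *m h)).

(* In terms of r, the coefficient vector of the square root of h:
   P(r) r = h. *)
Definition root_flux r q : 'cV[R]_(K + K) :=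
  col_mx q (P (invmx (P r) *m q) *m invmx (P r) *m q
            + (g / 2) *: (P (P r *m r) *m P r *m r)).

(* Balance law at the point (t, x), in the classical sense: dU/dt + dF/dx
   = S, with U = (h, q), F the flux evaluated along the solution and
   S = (0, - g P(h) db/dx).  Fields depend on time first. *)
Definition balance_law (h q : R -> R -> 'cV[R]_K)
    (F : R -> R -> 'cV[R]_(K + K)) (b : R -> R -> 'cV[R]_K) (t x : R) : Prop :=
  let U := fun s y => col_mx (h s y) (q s y) in
  [/\ derivable (U ^~ x) t 1, derivable (F t) x 1, derivable (b t) x 1 &
      'D_1 (U ^~ x) t + 'D_1 (F t) x =
      col_mx 0 (- (g *: (P (h t x) *m 'D_1 (b t) x)))].

Definition swe (h q b : R -> R -> 'cV[R]_K) (t x : R) : Prop :=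
  balance_law h q (fun s y => flux (h s y) (q s y)) b t x.

Definition root_swe (h r q b : R -> R -> 'cV[R]_K) (t x : R) : Prop :=
  balance_law h q (fun s y => root_flux (r s y) (q s y)) b t x.

End ShallowWater.

(* Main.v *)
Require Import Defs.
From HB Require Import structures.
From mathcomp Require Import all_boot all_order all_algebra.
From mathcomp Require Import all_classical all_reals all_analysis.
Import Order.TTheory GRing.Theory Num.Theory.
Import numFieldNormedType.Exports.

(** Read [P v *m w] as a bilinear product [v * w] on coefficient vectors, so
    that [P v] is multiplication by [v].  The product is commutative because the
    triple products are symmetric in their indices ([galerkin_mulC]).  Under
    (P1) all the matrices [P v] are diagonal in one orthonormal basis, hence
    they commute with each other ([property_P1_comm]).  For a commutative
    product, commuting multiplication operators are the same as associativity,

      u * (v * w) = u * (w * v) = w * (u * v) = (u * v) * w,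

    and so [P] turns the product of vectors into the product of matrices
    ([mul_op_morph]).

    If [r * r = h] then [P h = P r *m P r]; since [P h] is positive definite,
    [P r] is invertible.  By the same rule [P r *m P (invmx (P r) *m q) = P q],
    that is, [P (invmx (P r) *m q) = invmx (P r) *m P q].  Both momentum fluxes
    therefore contain [P q *m invmx (P r) *m invmx (P r) *m q], up to the order
    of commuting factors, and the hydrostatic terms agree by substituting
    [h = r * r].  This is [flux_root_flux].

    The balance laws see the flux only through its germ in [x] at the point
    considered, so the equality of fluxes on a neighbourhood of that point makes
    the two systems equivalent ([eq_near_balance_law]). *)

Set Implicit Arguments.
Unset Strict Implicit.
Unset Printing Implicit Defensive.

Local Open Scope classical_set_scope.
Local Open Scope ring_scope.

Lemma mulmx_cV_inj (R : pzSemiRingType) m n (A B : 'M[R]_(m, n)) :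
  (forall u : 'cV_n, A *m u = B *m u) -> A = B.
Proof.
move=> AB; apply/matrixP => i j.
by have /colP/(_ i) := AB (delta_mx j 0); rewrite -!colE !mxE.
Qed.

Lemma posdefmx_unit (R : realType) K (A : 'M[R]_K) :
  posdefmx A -> A \in unitmx.
Proof.
case=> _ Apos; rewrite -row_free_unit; apply: inj_row_free => v vA0.
apply/eqP; apply: contraT => v0.
have := Apos v^T; rewrite trmx_eq0 trmxK vA0 mul0mx mxE ltxx.
by move=> /(_ v0).
Qed.

Lemma comm_invmx (R : comUnitRingType) n (A B : 'M[R]_n) :
  A \in unitmx -> A *m B = B *m A -> invmx A *m B = B *m invmx A.
Proof. by move=> uA AB; rewrite -[B in LHS](mulmxK uA) -AB -mulmxA mulKmx. Qed.

Section CommutativeProduct.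
Context (R : comUnitRingType) (K : nat) (P : 'cV[R]_K -> 'M[R]_K).

Lemma mul_op_morph :
  (forall v w, P v *m w = P w *m v) ->
  (forall v w, P v *m P w = P w *m P v) ->
  forall v w, P (P v *m w) = P v *m P w.
Proof.
move=> mulC opC v w; apply: mulmx_cV_inj => u.
by rewrite mulC [P v *m w]mulC mulmxA opC -mulmxA [P u *m v]mulC mulmxA opC.
Qed.

Lemma mul_op_div :
  (forall v w, P (P v *m w) = P v *m P w) ->
  forall v w, P v \in unitmx -> P (invmx (P v) *m w) = invmx (P v) *m P w.
Proof.
by move=> morP v w uv; rewrite -[w in RHS](mulKVmx uv) morP mulKmx.
Qed.

End CommutativeProduct.

(** Since [P h] is the square of [P r], its positive definiteness is needed only
    to make [P r] invertible; the fluxes then differ by the order of the factors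
    [P q] and [invmx (P r)], which commute. *)
Lemma flux_root_flux (R : realType) K (g : R) (P : 'cV[R]_K -> 'M[R]_K) :
  (forall v w, P v *m w = P w *m v) ->
  (forall v w, P v *m P w = P w *m P v) ->
  forall h q r, posdefmx (P h) -> P r *m r = h ->
  flux g P h q = root_flux g P r q.
Proof.
move=> mulC opC h q r /posdefmx_unit uh rr.
have morP := mul_op_morph mulC opC.
have Phr : P h = P r *m P r by rewrite -rr morP.
have ur : P r \in unitmx by move: uh; rewrite Phr unitmx_mul => /andP[].
have invPh : invmx (P h) = invmx (P r) *m invmx (P r).
  by apply: (can_inj (mulKmx uh)); rewrite mulmxV // Phr -mulmxA mulKVmx ?mulmxV.
rewrite /flux /root_flux mul_op_div // (comm_invmx ur (opC r q)) invPh !mulmxA.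
by rewrite -[P (P r *m r) *m P r *m r]mulmxA rr.
Qed.

Section Galerkin.
Context (R : realType) (n K : nat).
Variables (rho : euclid R n -> R) (psi : 'I_K -> euclid R n -> R).

Lemma triple_productAC i j k :
  inner rho (psi i \* psi j) (psi k) = inner rho (psi i \* psi k) (psi j).
Proof. by congr Rintegral; apply/funext => s /=; rewrite (mulrAC (psi i s)). Qed.

Lemma galerkin_mulC (v w : 'cV[R]_K) :
  galerkin_mx rho psi v *m w = galerkin_mx rho psi w *m v.
Proof.
apply/colP => i; rewrite !mxE.
under eq_bigr do rewrite mxE mulr_suml.
rewrite exchange_big /=; apply: eq_bigr => k _; rewrite mxE mulr_suml.
by apply: eq_bigr => j _; rewrite triple_productAC mulrAC [v k 0 * _]mulrC mulrAC.
Qed.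

Lemma property_P1_comm (v w : 'cV[R]_K) : property_P1 rho psi ->
  galerkin_mx rho psi v *m galerkin_mx rho psi w =
  galerkin_mx rho psi w *m galerkin_mx rho psi v.
Proof.
case=> V [VtV diagP].
have [L [/diag_mxP[d ->] ->]] := diagP v.
have [M [/diag_mxP[e ->] ->]] := diagP w.
have conjM (A B : 'M[R]_K) :
    (V *m A *m V^T) *m (V *m B *m V^T) = V *m (A *m B) *m V^T.
  by rewrite !mulmxA -(mulmxA _ V^T) VtV mulmx1.
by rewrite !conjM diag_mxC.
Qed.

End Galerkin.

(** A derivative at a point depends only on the germ of the function there; the
    flux enters a balance law only through its derivative in [x]. *)
Lemma eq_near_balance_law (R : realType) K (g : R) (P : 'cV[R]_K -> 'M[R]_K)
    (h q : R -> R -> 'cV[R]_K) (F G : R -> R -> 'cV[R]_(K + K))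
    (b : R -> R -> 'cV[R]_K) (t x : R) :
  (\forall y \near x, F t y = G t y) ->
  balance_law g P h q F b t x -> balance_law g P h q G b t x.
Proof.
move=> FG [dU dF db eqn]; split => //; first exact: near_eq_derivable dF.
by rewrite -(near_eq_derive _ FG).
Qed.

Theorem theorem3p1 (R : realType) (n K : nat)
    (rho : euclid R n -> R) (psi : 'I_K -> euclid R n -> R) (g : R)
    (P := galerkin_mx rho psi) :
  probability_density rho ->
  orthonormal_family rho psi ->
  finite_triple_products rho psi ->
  0 < g ->
  property_P1 rho psi ->
  (forall h q r : 'cV[R]_K, posdefmx (P h) -> P r *m r = h ->
     flux g P h q = root_flux g P r q) /\
  (forall (h q r b : R -> R -> 'cV[R]_K) (t x : R),
     (\forall y \near x, posdefmx (P (h t y)) /\ P (r t y) *m r t y = h t y) ->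
     swe g P h q b t x <-> root_swe g P h r q b t x).
Proof.
move=> _ _ _ _ P1.
have fluxE := flux_root_flux g (galerkin_mulC rho psi)
                (fun v w => property_P1_comm v w P1).
split=> [|h q r b t x rootP]; first exact: fluxE.
have fluxE_near :
    \forall y \near x, flux g P (h t y) (q t y) = root_flux g P (r t y) (q t y).
  by apply: filterS rootP => y [hpos rr]; exact: fluxE.
split; apply: eq_near_balance_law => //.
by apply: filterS fluxE_near => y ->.
Qed.
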